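(* Let $M=M_0$ be a model set with $0\notin S$ and hull $\Omega_M$. If $\partial K$ has Haar measure zero in $H$ (the model set is regular), then the set of fiber distal points of $\mathbb T$ (with respect to $\mu:\Omega_M\to\mathbb T$) has full Haar measure in $\mathbb T$. If $\partial K$ has positive Haar measure, then the set of fiber distal points has Haar measure zero.
   Context: Let $H$ be a locally compact abelian group with neutral element $e$, $\Gamma\subset\mathbb R^n\times H$ a lattice (discrete co-compact subgroup), $\pi^\|,\pi^\perp$ the projections onto $\mathbb R^n$ and $H$, whose restrictions to $\Gamma$ are injective with dense image. $K\subset H$ is compact, the closure of its interior, with trivial stabilizer. $M_x=\{\pi^\|(\gamma+x):\gamma\in\Gamma,\ \pi^\perp(\gamma+x)\in K\}$, $S=\{x\in\mathbb R^n\times H:\pi^\perp(x)\in\partial K+\pi^\perp(\Gamma)\}$, $NS$ its complement. $\Omega_M$ is the hull of $M$ with the $\mathbb R^n$ translation action, $\mathbb T=(\mathbb R^n\times H)/\Gamma$ with $v\cdot(x+\Gamma)=(x+(v,e))+\Gamma$ and normalized Haar measure. The continuous equivariant surjection $\mu:\Omega_M\to\mathbb T$ extending $M_x\mapsto x+\Gamma$ ($x\in NS$), injective exactly over $NS/\Gamma$, is the maximal equicontinuous factor. A point of $\Omega_M$ is distal if it is proximal ($\inf_v d(L-v,L'-v)=0$) to no other point; a point $z\in\mathbb T$ is fiber distal if all points of $\mu^{-1}(z)$ are distal. *)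

(* Defs.v *)
From HB Require Import structures.
From mathcomp Require Import all_boot all_order all_algebra.
From mathcomp Require Import all_classical all_reals all_analysis.
Set Implicit Arguments. Unset Strict Implicit. Unset Printing Implicit Defensive.
Import Order.TTheory GRing.Theory Num.Theory.
Import numFieldNormedType.Exports.
Local Open Scope classical_set_scope.
Local Open Scope ring_scope.

(* pointed aliases (the base point 0 is irrelevant; it is only needed to
   build the generated sigma-algebra structure) *)
Definition ptd (G : zmodType) : Type := G.
HB.instance Definition _ (G : zmodType) := Choice.on (ptd G).
HB.instance Definition _ (G : zmodType) := isPointed.Build (ptd G) (0 : G).

Definition translate {G : zmodType} (A : set G) (y : G) : set G :=
  [set x + y | x in A].

Definition bdry {T : topologicalType} (A : set T) : set T :=
  closure A `\` interior A.

Section ModelSets.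
Variables (R : realType) (n : nat) (H : topologicalZmodType).
Local Notation V := 'rV[R]_n.
Local Notation E := (V * H)%type.

Definition is_lattice (Gam : set E) : Prop :=
  [/\ Gam 0,
      (forall a b, Gam a -> Gam b -> Gam (a - b)),
      (forall g, Gam g -> exists U : set E, open U /\ U `&` Gam = [set g])
    & exists C : set E, compact C /\
        forall x : E, exists c g, [/\ C c, Gam g & x = c + g]].

Definition proj_conditions (Gam : set E) : Prop :=
  [/\ (forall a b, Gam a -> Gam b -> a.1 = b.1 -> a = b),
      (forall a b, Gam a -> Gam b -> a.2 = b.2 -> a = b),
      dense [set g.1 | g in Gam]
    & dense [set g.2 | g in Gam]].

Definition is_window (K : set H) : Prop :=
  [/\ compact K, K = closure (interior K)
    & forall h : H, translate K h = K -> h = 0].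

Definition modelset (Gam : set E) (K : set H) (x : E) : set V :=
  [set (g + x).1 | g in [set g | Gam g /\ K (g + x).2]].

Definition Ssing (Gam : set E) (K : set H) : set E :=
  [set x | exists k g, [/\ bdry K k, Gam g & x.2 = k + g.2]].

(* eps-closeness of point sets (local rubber / local topology) *)
Definition close1 (eps : R) (A B : set V) : Prop :=
  forall a, A a -> `|a| < eps^-1 -> exists b, B b /\ `|a - b| < eps.
Definition close (eps : R) (A B : set V) : Prop :=
  close1 eps A B /\ close1 eps B A.

Definition hull (M : set V) : set (set V) :=
  [set L | forall eps, 0 < eps -> exists v : V, close eps L (translate M v)].

Definition proximal (L L' : set V) : Prop :=
  forall eps, 0 < eps -> exists v : V, close eps (translate L v) (translate L' v).

Definition distal (Om : set (set V)) (L : set V) : Prop :=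
  forall L', Om L' -> proximal L L' -> L' = L.

(* open sets of T = (R^n x H)/Gam, viewed as Gam-invariant open subsets *)
Definition Topen (Gam : set E) (A : set E) : Prop :=
  open A /\ forall x g, Gam g -> A x -> A (x + g).

(* compact subsets of T, viewed as Gam-invariant subsets *)
Definition Tcompact (Gam : set E) (A : set E) : Prop :=
  exists C : set E, compact C /\ A = [set c + g | c in C & g in Gam].

(* Borel measurable space of T (on Gam-invariant subsets of R^n x H) *)
Definition Tm (Gam : set E) : measurableType _ :=
  @g_sigma_algebraType (ptd E) (Topen Gam).

Definition is_haarT (Gam : set E) (m : {measure set (Tm Gam) -> \bar R}) : Prop :=
  [/\ m setT = 1%E,
      (forall (A : set (Tm Gam)) (y : E), measurable A ->
          m (translate (A : set E) y) = m A),
      (forall (A : set (Tm Gam)), measurable A ->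
          m A = ereal_inf [set m U | U in [set U | Topen Gam U /\ A `<=` U]])
    & (forall U : set E, Topen Gam U ->
          m U = ereal_sup [set m C | C in [set C | Tcompact Gam C /\ C `<=` U]])].

(* mu : Omega_M -> T, represented by a function to R^n x H taken mod Gam:
   continuous, equivariant, surjective, mapping M_x to x + Gam for x in NS *)
Definition is_factor_map (Gam : set E) (K : set H) (mu : set V -> E) : Prop :=
  let Om := hull (modelset Gam K 0) in
  [/\ (forall x, ~ Ssing Gam K x -> Gam (mu (modelset Gam K x) - x)),
      (forall L (v : V), Om L -> Gam (mu (translate L v) - (mu L + (v, 0)))),
      (forall L U, Om L -> Topen Gam U -> U (mu L) ->
          exists2 eps, 0 < eps & forall L', Om L' -> close eps L L' -> U (mu L'))
    & (forall z, exists L, Om L /\ Gam (mu L - z))].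

Definition fiber_distal (Gam : set E) (K : set H) (mu : set V -> E) (z : E) : Prop :=
  let Om := hull (modelset Gam K 0) in
  forall L, Om L -> Gam (mu L - z) -> distal Om L.

End ModelSets.

Definition Hm (H : topologicalZmodType) : measurableType _ :=
  @g_sigma_algebraType (ptd H) (@open H).

Definition is_haar (R : realType) (H : topologicalZmodType)
    (m : {measure set (Hm H) -> \bar R}) : Prop :=
  [/\ (forall (A : set (Hm H)) (h : H), measurable A ->
          m (translate (A : set H) h) = m A),
      (forall C : set H, compact C -> (m C < +oo)%E),
      (forall U : set H, open U -> U !=set0 -> (0 < m U)%E),
      (forall (A : set (Hm H)), measurable A ->
          m A = ereal_inf [set m U | U in [set U : set H | open U /\ A `<=` U]])
    & (forall U : set H, open U ->
          m U = ereal_sup [set m C | C in [set C : set H | compact C /\ C `<=` U]])].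

(* Main.v *)
(** Fibre distality of [z] is equivalent to [z] being nonsingular,
    i.e. [z] not in [S]. A hull element [L] over [z] is a limit of model sets
    [M_(z+u)] with [u -> 0], hence lies between the model sets of [z] with
    windows [interior K] and [K]; these agree when [z] is nonsingular, so the
    fibre is then a point. Proximal elements lie in the same fibre, because a
    cluster point of the translates compares windows and the stabilizer of [K]
    is trivial. Conversely all elements of a fibre are proximal to each other:
    translating [z] close to the nonsingular point 0 makes their common bounds
    coincide on any prescribed ball. Over a singular [z] a lattice point sits on
    the boundary of the window, and approaching it from inside and from outside
    along ultrafilters gives two distinct elements of the fibre.

    It remains to compare Haar measures on [H] and on the torus. [S] is the union
    of the sets [B x bdry K + Gam], [B] a ball. Cutting a compact [Q] in [H] into
    small pieces [P_i] around points [y_i] and averaging the translates by [y_i]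
    with the weights [mH P_i] is a discretized Fubini argument that needs no
    countability of [H]. It gives [mT S = 0] when [mH (bdry K) = 0]; when
    [mH (bdry K) > 0], choosing the [y_i] in the dense projection of [Gam]
    it gives the ergodicity statement [mT (~` S) = 0]. *)
Require Import Defs.
From HB Require Import structures.
From mathcomp Require Import all_boot all_order all_algebra.
From mathcomp Require Import all_classical all_reals all_analysis.
From mathcomp Require Import measurable_realfun lra.
Import Order.TTheory GRing.Theory Num.Theory.
Import numFieldNormedType.Exports.
Local Open Scope classical_set_scope.
Local Open Scope ring_scope.

Set Implicit Arguments. Unset Strict Implicit. Unset Printing Implicit Defensive.

(** * Deciding linear identities in abelian groups *)

Inductive zmod_expr :=
  | ZVar of nat | ZZero | ZAdd of zmod_expr & zmod_expr | ZOpp of zmod_expr.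

Section ZmodExpr.
Variable G : zmodType.

Fixpoint zmod_eval (env : seq G) e : G :=
  match e with
  | ZVar i => nth 0 env i
  | ZZero => 0
  | ZAdd e1 e2 => zmod_eval env e1 + zmod_eval env e2
  | ZOpp e1 => - zmod_eval env e1
  end.

Fixpoint zmod_coef e (i : nat) : int :=
  match e with
  | ZVar j => (i == j)%:Z
  | ZZero => 0
  | ZAdd e1 e2 => zmod_coef e1 i + zmod_coef e2 i
  | ZOpp e1 => - zmod_coef e1 i
  end.

Lemma zmod_evalE env e :
  zmod_eval env e = \sum_(i < size env) env`_i *~ zmod_coef e i.
Proof.
elim: e => [j| |e1 IH1 e2 IH2|e IH] /=.
- have [jlt|jge] := ltnP j (size env); last first.
    rewrite nth_default// big1// => i _.
    by rewrite (ltn_eqF (leq_trans (ltn_ord i) jge)).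
  by rewrite (bigD1 (Ordinal jlt))//= eqxx big1 ?addr0// => i /eqP ij;
    case: eqP => // ij'; case: ij; exact: val_inj.
- by rewrite big1.
- by rewrite IH1 IH2 -big_split; apply: eq_bigr => i _; rewrite mulrzDr.
- by rewrite IH -sumrN; apply: eq_bigr => i _; rewrite mulrNz.
Qed.

(** Reflection: the hypothesis is decided by computation, and indices up to the length of [env]
    suffice because later variables evaluate to 0. *)
Lemma zmod_exprP env e1 e2 :
  all (fun i => zmod_coef e1 i == zmod_coef e2 i) (iota 0 (size env)) ->
  zmod_eval env e1 = zmod_eval env e2.
Proof.
move=> /allP h; rewrite !zmod_evalE; apply: eq_bigr => i _.
by rewrite (eqP (h i _))// mem_iota add0n ltn_ord.
Qed.

End ZmodExpr.

(* Atoms are compared up to unification: equal atoms such as (v, 0) may carry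
   different canonical instances. *)
Ltac zmod_index x env :=
  match env with
  | ?y :: _ => let _ := match goal with _ => unify x y end in constr:(0%N)
  | _ :: ?l => let i := zmod_index x l in constr:(S i)
  end.

Ltac zmod_env e env :=
  match e with
  | ?a + ?b => let env := zmod_env a env in zmod_env b env
  | - ?a => zmod_env a env
  | 0 => env
  | ?x => match env with
          | _ => let _ := zmod_index x env in env
          | _ => constr:(x :: env)
          end
  end.

Ltac zmod_reify e env :=
  match e with
  | ?a + ?b => let a := zmod_reify a env in let b := zmod_reify b env in
               constr:(ZAdd a b)
  | - ?a => let a := zmod_reify a env in constr:(ZOpp a)
  | 0 => constr:(ZZero)
  | ?x => let i := zmod_index x env in constr:(ZVar i)
  end.

Ltac zmod :=
  match goal with
  | |- @eq ?T ?a ?b =>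
      let env := zmod_env a (@nil T) in
      let env := zmod_env b env in
      let ea := zmod_reify a env in
      let eb := zmod_reify b env in
      exact: (@zmod_exprP _ env ea eb)
  end.

(** * Topological groups *)

Section ProdTopologicalZmod.
Variables U V : topologicalZmodType.

(* MathComp-Analysis gives products a topological group structure only for
   tvs factors, hence the alias. *)
Definition prod_group : Type := (U * V)%type.

Let prod_sub_continuous :
  continuous (fun x : (U * V) * (U * V) => x.1 - x.2).
Proof.
move=> x.
have h1 : {for x, continuous (fun y : (U * V) * (U * V) => y.1.1 - y.2.1)}.
  apply: (@continuous_comp _ _ _ (fun y : (U * V) * (U * V) => (y.1.1, y.2.1))
    (fun y : U * U => y.1 - y.2)); last exact: sub_continuous.
  apply: cvg_pair.
    by apply: (@continuous_comp _ _ _ fst fst); exact: cvg_fst.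
  by apply: (@continuous_comp _ _ _ snd fst); [exact: cvg_snd|exact: cvg_fst].
have h2 : {for x, continuous (fun y : (U * V) * (U * V) => y.1.2 - y.2.2)}.
  apply: (@continuous_comp _ _ _ (fun y : (U * V) * (U * V) => (y.1.2, y.2.2))
    (fun y : V * V => y.1 - y.2)); last exact: sub_continuous.
  apply: cvg_pair.
    by apply: (@continuous_comp _ _ _ fst snd); [exact: cvg_fst|exact: cvg_snd].
  by apply: (@continuous_comp _ _ _ snd snd); exact: cvg_snd.
have -> : (fun y : (U * V) * (U * V) => y.1 - y.2) =
    (fun y : (U * V) * (U * V) => (y.1.1 - y.2.1, y.1.2 - y.2.2)).
  by apply/funext => -[[? ?] [? ?]].
exact: cvg_pair h1 h2.
Qed.

HB.instance Definition _ := Topological.copy prod_group (U * V)%type.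
HB.instance Definition _ := GRing.Zmodule.copy prod_group (U * V)%type.
HB.instance Definition _ :=
  PreTopologicalNmodule_isTopologicalZmodule.Build prod_group prod_sub_continuous.

End ProdTopologicalZmod.

Lemma translateE (G : zmodType) (A : set G) (y : G) : translate A y = [set x | A (x - y)].
Proof.
apply/seteqP; split => x /=; first by move=> [a Aa <-]; rewrite addrK.
by exists (x - y) => //; rewrite subrK.
Qed.

Section TopologicalGroups.
Variable G : topologicalZmodType.
Implicit Types (x y : G) (A C N : set G).

Lemma cvg_addl x y : x + u @[u --> y] --> x + y.
Proof.
apply: (@continuous_comp _ _ _ (fun u : G => (x, u)) (fun u : G * G => u.1 + u.2)).
  by apply: cvg_pair; [exact: cvg_cst|exact: cvg_id].
exact: add_continuous.
Qed.

Lemma cvg_addr x y : u + x @[u --> y] --> y + x.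
Proof. by rewrite addrC; under eq_fun do rewrite addrC; exact: cvg_addl. Qed.

Lemma near_add x y N : nbhs (x + y) N -> \forall u \near x & v \near y, N (u + v).
Proof. exact: (@add_continuous G (x, y)). Qed.

Lemma near_sub x y N : nbhs (x - y) N -> \forall u \near x & v \near y, N (u - v).
Proof. exact: (@sub_continuous G (x, y)). Qed.

Lemma near_add0 x N : nbhs x N -> \forall u \near (0 : G), N (x + u).
Proof. by rewrite -{1}[x]addr0; exact: cvg_addl. Qed.

Lemma nbhs_subr x N : nbhs (0 : G) N -> nbhs x [set y | N (y - x)].
Proof. by move=> N0; have := @cvg_addr (- x) x; rewrite subrr => /(_ _ N0). Qed.

Lemma open_shift A x : open A -> open [set y | A (y + x)].
Proof. by move=> oA; apply: open_comp => // y _; exact: cvg_addr. Qed.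

Lemma compact_tube C N : compact C -> open N -> C `<=` N ->
  \forall w \near (0 : G), forall c, C c -> N (c + w).
Proof.
move=> /compact_near_coveringP + oN CN; apply => x Cx.
by apply: near_add; rewrite addr0; apply: open_nbhs_nbhs; split => //; exact: CN.
Qed.

Lemma compact_sub A C : compact A -> compact C ->
  compact [set x.1 - x.2 | x in A `*` C].
Proof.
move=> cA cC; apply: continuous_compact; last exact: compact_setX.
by apply: continuous_subspaceT => x; exact: sub_continuous.
Qed.

(** The near-covering form of compactness is applied to the filter of finite lists of points of [Y],
    directed by inclusion, so that one list eventually serves all of [C]. *)
Lemma compact_cover_shifts C Y N : compact C -> open N ->
  (forall x, C x -> exists2 y, Y y & N (x - y)) ->
  exists s : seq G, (forall y, y \in s -> Y y) /\
    forall x, C x -> exists2 y, y \in s & N (x - y).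
Proof.
move=> /compact_near_coveringP cC oN CY.
pose B (s0 : seq G) := [set s : seq G | {subset s0 <= s} /\ forall y, y \in s -> Y y].
pose F := filter_from [set s : seq G | forall y, y \in s -> Y y] B.
have FF : Filter F.
  apply: filter_from_filter; first by exists [::].
  move=> s t sY tY; exists (s ++ t).
    by move=> y; rewrite mem_cat => /orP[/sY|/tY].
  move=> r [str rY]; do 2?split => //.
    by move=> y ys; apply: str; rewrite mem_cat ys.
  by move=> y yt; apply: str; rewrite mem_cat yt orbT.
have [|s0 s0Y Bs] := cC _ F (fun s x => exists2 y, y \in s & N (x - y)) FF.
  move=> x /CY[y Yy Nxy]; exists ([set x' | N (x' - y)], B [:: y]).
    split; first by apply: open_nbhs_nbhs; split => //; exact: open_shift.
    by exists [:: y] => // y0 /=; rewrite inE => /eqP ->.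
  by move=> [x' s] /= [Nx' [ys _]]; exists y => //; apply: ys; rewrite inE.
by exists s0; split => //; apply: Bs; split.
Qed.

End TopologicalGroups.

Lemma hausdorff_prod (U V : topologicalType) :
  hausdorff_space U -> hausdorff_space V -> hausdorff_space (U * V)%type.
Proof.
move=> hU hV [a b] [c d] clab; congr pair.
  apply: hU => A C aA cC.
  have nA : nbhs (a, b) (A `*` setT) by exists (A, setT) => //; split => //; exact: filterT.
  have nC : nbhs (c, d) (C `*` setT) by exists (C, setT) => //; split => //; exact: filterT.
  by have [[x y] [/= [Ax _] [Cx _]]] := clab _ _ nA nC; exists x.
apply: hV => A C aA cC.
have nA : nbhs (a, b) (setT `*` A) by exists (setT, A) => //; split => //; exact: filterT.
have nC : nbhs (c, d) (setT `*` C) by exists (setT, C) => //; split => //; exact: filterT.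
by have [[x y] [/= [_ Ay] [_ Cy]]] := clab _ _ nA nC; exists y.
Qed.

(** * Discrete subgroups of Hausdorff groups *)

Section DiscreteSubgroup.
Variables (G : topologicalZmodType) (Gam : set G).
Hypotheses (hG : hausdorff_space G) (Gam0 : Gam 0)
  (GamB : forall a b, Gam a -> Gam b -> Gam (a - b))
  (Gamd : \forall g \near (0 : G), Gam g -> g = 0).

Lemma discrete_near_eq (x : G) :
  \forall y \near x & z \near x, Gam (y - z) -> y = z.
Proof.
have := @near_sub G x x (fun g => Gam g -> g = 0); rewrite subrr => /(_ Gamd).
by apply: filterS => -[y z] /= h /h /eqP; rewrite subr_eq0 => /eqP.
Qed.

Lemma discrete_isolated (x : G) : \forall y \near x, Gam y -> y = x.
Proof.
have [[N1 N2] /= [n1 n2] N12] := discrete_near_eq x.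
have nN : nbhs x (N1 `&` N2) by exact: filterI.
have [[y [Ny Gy]]|noy] := pselect (exists y, (N1 `&` N2) y /\ Gam y); last first.
  by apply: filterS nN => y Ny Gy; case: noy; exists y.
have uniq z : (N1 `&` N2) z -> Gam z -> z = y.
  by move=> [N1z N2z] Gz; apply: (N12 (z, y)) => /=; [split=> //; case: Ny|exact: GamB].
have [xy|xy] := pselect (x = y).
  by apply: filterS nN => z Nz Gz; rewrite (uniq z Nz Gz) xy.
suff nzy : \forall z \near x, z <> y
  by apply: filterS2 nN nzy => z Nz zy Gz; case: (zy (uniq _ Nz Gz)).
have cy := @accessible_closed_set1 _ (hausdorff_accessible hG) y.
by apply: open_nbhs_nbhs; split => //; exact: closed_openC.
Qed.

(** For [p] outside, no [p - c] lies in [Gam]. By isolation this persists near [p] and [c], and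
    compactness of [C] gives one neighbourhood of [p] for all [c]. *)
Lemma compact_add_discrete_closed (C : set G) : compact C ->
  closed [set c + g | c in C & g in Gam].
Proof.
move=> /compact_near_coveringP cC; rewrite closedE => p np.
apply: contrapT => Cp; apply: np.
suff : \forall q \near p, forall c, C c -> ~ Gam (q - c).
  by apply: filterS => q qC [c Cc [g Gg qE]]; apply: (qC c Cc); rewrite -qE addrC addKr.
apply: cC => c Cc; have nGpc : ~ Gam (p - c).
  by move=> Gpc; apply: Cp; exists c => //; exists (p - c) => //; rewrite addrC subrK.
have := @near_sub G p c (fun g => ~ Gam g).
have : nbhs (p - c) (fun g => ~ Gam g).
  by apply: filterS (discrete_isolated (p - c)) => y h Gy; apply: nGpc; rewrite -(h Gy).
move=> + h => /h.
by case=> -[N1 N2] /= [n1 n2] N12; exists (N2, N1) => //= -[c' q] [/= ? ?]; exact: (N12 (q, c')).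
Qed.

End DiscreteSubgroup.

(** * The hull and its fibres over the torus *)

Section ModelSetHull.
Variables (R : realType) (n : nat) (H : topologicalZmodType).
Local Notation V := 'rV[R]_n.
Local Notation E := (V * H)%type.
Local Notation G := (prod_group V H).
Variables (Gam : set E) (K : set H).
Hypotheses (hH : hausdorff_space H) (lat : is_lattice Gam)
  (prj : proj_conditions Gam) (win : is_window K).
Implicit Types (B : set V) (D : set H) (L M : set V) (x y z u g : E) (v a b : V).

Lemma lattice0 : Gam 0. Proof. by case: lat. Qed.

Lemma latticeB x y : Gam x -> Gam y -> Gam (x - y).
Proof. by case: lat => _ + _ _; exact. Qed.

Lemma latticeN x : Gam x -> Gam (- x).
Proof. by move=> gx; rewrite -[- x]add0r; exact: latticeB lattice0 gx. Qed.

Lemma latticeD x y : Gam x -> Gam y -> Gam (x + y).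
Proof. by move=> gx gy; rewrite -[y]opprK; exact: latticeB gx (latticeN gy). Qed.

Lemma hausdorff_space_VH : hausdorff_space E.
Proof. exact: hausdorff_prod (@norm_hausdorff _ _) hH. Qed.

Lemma lattice_discrete : \forall g \near (0 : E), Gam g -> g = 0.
Proof.
have [_ _ + _] := lat; move=> /(_ 0 lattice0)[U [oU U0]].
have [U00 _] : (U `&` Gam) 0 by rewrite U0.
have : nbhs (0 : E) U by apply: open_nbhs_nbhs.
by apply: filterS => g Ug gg; have : (U `&` Gam) g by []; rewrite U0.
Qed.

Lemma nbhs0_box (N : set E) : nbhs (0 : E) N -> exists2 r : R, 0 < r &
  exists2 N2 : set H, nbhs 0 N2 & forall w, `|w.1| < r -> N2 w.2 -> N w.
Proof.
move=> [[N1 N2] /= [n1 n2] N12]; have /nbhs_norm0P[r /= r0 rN] := n1.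
exists r => //; exists N2 => // w wr w2; apply: N12; split => //=; exact: rN.
Qed.

Lemma near0_fst (r : R) : 0 < r -> \forall w \near (0 : E), `|w.1| < r.
Proof.
move=> r0; exists ([set v | `|v| < r], setT); last by move=> w [].
by split; [exact: (@nbhs0_lt _ V)|exact: filterT].
Qed.

Lemma near0_snd (N : set H) : nbhs 0 N -> \forall w \near (0 : E), N w.2.
Proof.
by move=> n0; exists (setT, N); [split => //; exact: filterT|move=> w []].
Qed.

Lemma compact_norm_le (r : R) : compact [set v : V | `|v| <= r].
Proof.
apply: bounded_closed_compact.
  exists r; split; first exact: num_real.
  by move=> M rM v /= /le_trans; apply; exact: ltW.
have -> : [set v : V | `|v| <= r] = Num.norm @^-1` [set x | x <= r] by [].
by apply: closed_comp; [move=> v _; exact: norm_continuous|exact: closed_le].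
Qed.

(** * Boxes saturated by the lattice, and model sets as their fibres *)

Definition slab B D : set E := [set c + g | c in B `*` D & g in Gam].

Lemma slabP B D z :
  slab B D z <-> exists g, [/\ Gam g, B (g + z).1 & D (g + z).2].
Proof.
split=> [[[b d] /= [Bb Dd] [g gg <-]]|[g [gg Bz Dz]]].
  have e : - g + ((b, d) + g) = (b, d) by zmod.
  exists (- g); split; first exact: latticeN.
    by move: (congr1 fst e) => /= ->.
  by move: (congr1 snd e) => /= ->.
exists (g + z) => //; exists (- g); first exact: latticeN.
zmod.
Qed.

Lemma slab_closed B D : compact B -> compact D -> closed (slab B D).
Proof.
move=> cB cD; rewrite /slab.
apply: (@compact_add_discrete_closed G).
- exact: hausdorff_space_VH.
- exact: latticeB.
- exact: lattice_discrete.
- exact: compact_setX.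
Qed.

Lemma slab_limit B D z : compact B -> compact D ->
  (forall N : set E, nbhs (0 : E) N -> exists2 w, N w & slab B D (z + w)) -> slab B D z.
Proof.
move=> cB cD h; apply: slab_closed => // N nN.
have [w Nw sw] := h _ (@near_add0 G z N nN).
by exists (z + w).
Qed.

Lemma slab_shift B D x y : Gam (x - y) -> slab B D x -> slab B D y.
Proof.
move=> gxy /slabP[g [gg Bg Dg]]; apply/slabP; exists (g + (x - y)).
have -> : g + (x - y) + y = g + x by zmod.
by split => //; exact: latticeD.
Qed.

Lemma latticeBC x y : Gam (x - y) -> Gam (y - x).
Proof. by move=> /latticeN; rewrite opprB. Qed.

Lemma mem_modelset D z a : modelset Gam D z a <-> slab [set a] D z.
Proof.
split=> [[g [gg Dg] <-]|/slabP[g [gg ga Dg]]]; first by apply/slabP; exists g.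
by exists g.
Qed.

Lemma modelset_shift D x y : Gam (x - y) -> modelset Gam D x = modelset Gam D y.
Proof.
move=> gxy; apply/seteqP; split => a /mem_modelset h; apply/mem_modelset.
  exact: slab_shift h.
by apply: slab_shift h; exact: latticeBC.
Qed.

Lemma translate_modelset D z v :
  translate (modelset Gam D z) v = modelset Gam D (z + (v, 0)).
Proof.
have e g : ((g + (z + (v, 0))).1 = (g + z).1 + v) * ((g + (z + (v, 0))).2 = (g + z).2).
  by split; rewrite /= ?addr0 ?addrA.
apply/seteqP; split => [_ [_ [g [gg Dg] <-] <-]|a [g [gg]]].
  by exists g; [split => //; rewrite e|rewrite e].
by rewrite e => Dg <-; rewrite e; exists (g + z).1 => //; exists g.
Qed.

Lemma Ssing_shift x y : x.2 = y.2 \/ Gam (x - y) -> Ssing Gam K x -> Ssing Gam K y.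
Proof.
move=> xy [k [g [Kk gg x2]]]; case: xy => [xy|gxy].
  by exists k, g; rewrite -xy.
exists k, (g - (x - y)); split => //; first exact: latticeB.
have -> : y.2 = x.2 - (x.2 - y.2) by zmod.
by rewrite {1}x2 /= addrA.
Qed.

Lemma bdry_compact : compact (bdry K).
Proof.
have [cK _ _] := win; apply: (subclosed_compact _ cK).
  rewrite /bdry setDE; apply: closedI; first exact: closed_closure.
  exact/open_closedC/open_interior.
by move=> k [+ _]; apply: compact_closed.
Qed.

Lemma bdryP k : K k -> ~ interior K k -> bdry K k.
Proof. by move=> Kk nKk; split => //; exact: subset_closure. Qed.

Lemma mem_closure_approx (A : set H) k : closure A k ->
  forall N : set H, nbhs 0 N -> exists2 u, N u & A (k + u).
Proof.
move=> clk N N0; have [x [Ax /= Nx]] := clk _ (nbhs_subr k N0).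
by exists (x - k) => //; rewrite addrC subrK.
Qed.

(** The [R^n]-orbit of 0 is dense in the torus: the free vector [v] matches the first coordinate
    exactly, and density of the second projection of [Gam] handles [H]. *)
Lemma dense_approx x (N : set E) : nbhs (0 : E) N ->
  exists v g u, [/\ Gam g, N u & x + u = (v, 0) + g].
Proof.
move=> /nbhs0_box[r r0 [N2 N20 rN]].
have [_ _ _ dG2] := prj.
have [] := dG2 (interior [set h | N2 (h - x.2)]).
- exists x.2; apply: nbhs_singleton; exact: nbhs_interior (nbhs_subr _ N20).
- exact: open_interior.
move=> h [/nbhs_singleton /= + [g gg gh]]; rewrite -{h}gh => Ng.
exists (x.1 - g.1), g, (0, g.2 - x.2); split => //.
  by apply: rN => //=; rewrite normr0.
case: x {Ng} => a h; case: g {gg} => b k; congr pair => /=; last by zmod.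
by rewrite addr0 subrK.
Qed.

(** * Fibres of the factor map, and proximality *)

Variable mu : set V -> E.
Hypotheses (NS0 : ~ Ssing Gam K 0) (fac : is_factor_map Gam K mu).
Local Notation Om := (hull (modelset Gam K 0)).

Let cK : compact K. Proof. by case: win. Qed.
Let clK : closed K. Proof. exact: compact_closed. Qed.

Lemma close_le (e e' : R) (A B : set V) : 0 < e' -> e' <= e ->
  Defs.close e' A B -> Defs.close e A B.
Proof.
move=> e'0 ee' [AB BA]; have e0 := lt_le_trans e'0 ee'.
have inv : e^-1 <= e'^-1 by rewrite lef_pV2.
have le1 (A' B' : set V) : close1 e' A' B' -> close1 e A' B'.
  move=> h a Aa ae; have [b [Bb ab]] := h a Aa (lt_le_trans ae inv).
  by exists b; split => //; exact: lt_le_trans ab ee'.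
by split; exact: le1.
Qed.

Lemma close_refl (e : R) (A : set V) : 0 < e -> Defs.close e A A.
Proof. by move=> e0; split=> a Aa _; exists a; rewrite subrr normr0. Qed.

Lemma exists_eps (c r : R) : 0 < r -> exists2 e : R, 0 < e & e <= r /\ c < e^-1.
Proof.
move=> r0; have c1 : 0 < `|c| + 1 by rewrite ltr_wpDl.
exists (Num.min r (`|c| + 1)^-1); first by rewrite lt_min r0 invr_gt0.
split; first by rewrite ge_min lexx.
apply: (@lt_le_trans _ _ (`|c| + 1)).
  by rewrite (le_lt_trans (ler_norm c))// ltrDl.
by rewrite -[leLHS]invrK lef_pV2 ?posrE ?invr_gt0// ?lt_min ?r0 ?invr_gt0// ge_min lexx orbT.
Qed.

Lemma hull_modelset v g : Gam g -> Om (modelset Gam K ((v, 0) + g)).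
Proof.
move=> gg e e0; exists v; rewrite translate_modelset add0r.
rewrite (@modelset_shift K ((v, 0) + g) (v, 0)); first exact: close_refl.
by have -> : (v, 0) + g - (v, 0) = g by zmod.
Qed.

Lemma NS_shift v g : Gam g -> ~ Ssing Gam K ((v, 0) + g).
Proof.
move=> gg h; apply: NS0; apply: (@Ssing_shift (v, 0)); first by left.
by apply: Ssing_shift h; right; have -> : (v, 0) + g - (v, 0) = g by zmod.
Qed.

(** Continuity of [mu] modulo [Gam], restated with a small displacement [u]; the test set is the
    union of the lattice translates of [mu L + interior N]. *)
Lemma fiber_cont L (N : set E) : Om L -> nbhs (0 : E) N ->
  exists2 e : R, 0 < e & forall L', Om L' -> Defs.close e L L' ->
    exists2 u, N u & Gam (mu L' - (mu L + u)).
Proof.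
move=> OmL nN; have [_ _ cont _] := fac.
pose U : set E := \bigcup_(g in Gam) [set y : E | interior N (y + (- g - mu L))].
have oU : Topen Gam U.
  split; first by apply: bigcup_open => g _; exact: (@open_shift G _ _ (@open_interior E N)).
  move=> x g gg [h gh /= Nx]; exists (h + g); first exact: latticeD.
  by rewrite /=; have -> : x + g + (- (h + g) - mu L) = x + (- h - mu L) by zmod.
have UL : U (mu L).
  exists 0; first exact: lattice0.
  by rewrite /=; have -> : mu L + (- 0 - mu L) = 0 by zmod.
have [e e0 h] := cont L U OmL oU UL.
exists e => // L' OmL' cl; have [g gg /= /nbhs_singleton Nu] := h L' OmL' cl.
exists (mu L' + (- g - mu L)) => //.
by have -> : mu L' - (mu L + (mu L' + (- g - mu L))) = g by zmod.
Qed.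

(** The hull supplies model sets of points [(v, 0)] close to [L]. These points are nonsingular, so
    [mu] sends the model sets to [(v, 0)], and continuity of [mu] puts [(v, 0)] near [z] modulo
    [Gam]. *)
Lemma hull_approx L z (e : R) (N : set E) :
  Om L -> Gam (mu L - z) -> 0 < e -> nbhs (0 : E) N ->
  exists u, N u /\ Defs.close e L (modelset Gam K (z + u)).
Proof.
move=> OmL gL e0 /(fiber_cont OmL)[e1 e10 h].
have m0 : 0 < Num.min e e1 by rewrite lt_min e0.
have [v] := OmL _ m0; rewrite translate_modelset add0r => cl.
have Omv : Om (modelset Gam K (v, 0)).
  by rewrite -[(v, 0)]addr0; exact: hull_modelset lattice0.
have nsv : ~ Ssing Gam K (v, 0) by rewrite -[(v, 0)]addr0; exact: NS_shift lattice0.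
have [|u Nu gu] := h _ Omv.
  by apply: close_le cl => //; rewrite ge_min lexx orbT.
exists u; split => //.
have [fac1 _ _ _] := fac.
rewrite (@modelset_shift K (z + u) (v, 0)); last first.
  have -> : z + u - (v, 0) = - (mu L - z) - (mu (modelset Gam K (v, 0)) - (mu L + u))
     + (mu (modelset Gam K (v, 0)) - (v, 0)) by zmod.
  apply: latticeD; last exact: fac1.
  by apply: latticeB => //; exact: latticeN.
by apply: close_le cl => //; rewrite ge_min lexx.
Qed.

(** A point of [L] is a limit of points of model sets of [z + u], and closedness of slabs over
    compact windows keeps it in the limit. *)
Lemma fiber_sub L z : Om L -> Gam (mu L - z) -> L `<=` modelset Gam K z.
Proof.
move=> OmL gL a La; apply/mem_modelset; apply: slab_limit => //.
  exact: compact_set1.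
move=> N /nbhs0_box[r r0 [N2 n2 rN]].
have r2 : 0 < r / 2 by lra.
have [e e0 [er ae]] := exists_eps `|a| r2.
have [u [[/= ur uN] [cl _]]] :=
  hull_approx OmL gL e0 (filterI (near0_fst r2) (near0_snd n2)).
have [b [[g [gg Kg] gb] ab]] := cl a La ae.
(* The displacement [u], corrected by [(a - b, 0)], carries the approximating point [b] exactly to
   [a]. *)
exists (u + (a - b, 0)).
  apply: rN => /=; last by rewrite addr0.
  by have := ler_normD u.1 (a - b); lra.
apply/slabP; exists g.
have ew : g + (z + (u + (a - b, 0))) = g + (z + u) + (a - b, 0) by zmod.
split => //; rewrite ew.
  change ((g + (z + u)).1 + (a - b) = a); rewrite gb; zmod.
by move: Kg => /=; rewrite addr0.
Qed.

(** Compactness of the window makes the isolation of the points of [Gam + z] uniform in the second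
    coordinate. *)
Lemma modelset_isolated a z : \forall b \near a, modelset Gam K z b -> b = a.
Proof.
have [+ _] := compact_near_coveringP K.
move=> /(_ cK V (nbhs a) (fun b k => Gam ((b, k) - z) -> b = a)) h.
have {}h : \forall b \near a, K `<=` (fun k => Gam ((b, k) - z) -> b = a).
  apply: h => k Kk.
  have di := @discrete_isolated G Gam hausdorff_space_VH latticeB lattice_discrete ((a, k) - z).
  have := @cvg_addr G (- z) (a, k) _ di.
  case=> -[A B] /= [nA nB] AB; exists (B, A) => // -[k' b] [/= Bk Ab] gb.
  by have /(_ gb) /addIr [] := AB (b, k') (conj Ab Bk).
apply: filterS h => b h [g [gg Kg] gb].
apply: (h (g + z).2) => //; have -> : (b, (g + z).2) = g + z by rewrite -gb.
by have -> : g + z - z = g by zmod.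
Qed.

(** A window coordinate in the open set [interior K] survives small [u], so [L] has a point [b] near
    [a]. By [fiber_sub], [b] lies in the model set of [z], where [a] is isolated. *)
Lemma fiber_sup L z : Om L -> Gam (mu L - z) -> modelset Gam (interior K) z `<=` L.
Proof.
move=> OmL gL a [g [gg ig] ga].
have /nbhs_normP[d /= d0 dN] := modelset_isolated a z.
have d2 : 0 < d / 2 by lra.
have [e e0 [ed ae]] := exists_eps (`|a| + d) d2.
have [u [[/= ud uK] [_ cl]]] :=
  hull_approx OmL gL e0 (filterI (near0_fst d2) (near0_snd (near_add0 ig))).
have [||b [Lb ab]] := cl (a + u.1).
- exists g; rewrite -?ga.
    by split => //; move: uK; rewrite /= addrA.
  by rewrite /= addrA.
- by have := ler_normD a u.1; lra.
suff <- : b = a by [].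
apply: (dN b) => /=; last exact: fiber_sub Lb.
have -> : a - b = (a + u.1 - b) - u.1 by zmod.
by have := ler_normB (a + u.1 - b) u.1; lra.
Qed.

Lemma modelset_NS z : ~ Ssing Gam K z ->
  modelset Gam K z `<=` modelset Gam (interior K) z.
Proof.
move=> nsz a [g [gg Kg] ga]; exists g => //; split => //.
apply: contrapT => nig; apply: nsz.
exists (g + z).2, (- g); split; [exact: bdryP|exact: latticeN|].
by rewrite /= addrC addKr.
Qed.

Lemma fiber_NS z L : ~ Ssing Gam K z -> Om L -> Gam (mu L - z) -> L = modelset Gam K z.
Proof.
move=> nsz OmL gL; apply/seteqP; split; first exact: fiber_sub.
by move=> a /(modelset_NS nsz); exact: fiber_sup.
Qed.

Lemma fiber_proximal L L' z : Om L -> Om L' -> Gam (mu L - z) -> Gam (mu L' - z) ->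
  proximal L L'.
Proof.
move=> OmL OmL' gL gL' e e0.
(* Outside [S] no lattice representative has position of norm at most [e^-1] and window coordinate
   in [bdry K], so the two bounds of a fibre agree on that ball. *)
pose S := slab [set v | `|v| <= e^-1] (bdry K).
have clS : closed S := slab_closed (@compact_norm_le e^-1) bdry_compact.
have S0 : ~ S 0.
  move=> /slabP[g [gg _]]; rewrite addr0 => bg; apply: NS0.
  by exists g.2, (- g); split => //; [exact: latticeN|rewrite /= subrr].
(* Density near [- z] yields [w] with [z + (w, 0)] congruent to a point [u] that avoids [S]. *)
have [w [g [u [gg Nu zu]]]] : exists v g u, [/\ Gam g, ~ S (u : E) & - z + u = (v, 0) + g].
  by apply: dense_approx; apply: open_nbhs_nbhs; split => //; exact: closed_openC.
have ue : u = (z + (w, 0)) + g by rewrite -addrA -zu; zmod.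
exists w.
have incl L1 L2 : Om L1 -> Om L2 -> Gam (mu L1 - z) -> Gam (mu L2 - z) ->
    close1 e (translate L1 w) (translate L2 w).
  move=> OmL1 OmL2 gL1 gL2 a [b Lb ba] ae; exists a; rewrite subrr normr0; split => //.
  have [h [gh Kh] hb] := fiber_sub OmL1 gL1 Lb.
  exists b => //; apply: (fiber_sup OmL2 gL2); exists h => //; split => //.
  apply: contrapT => nih; apply: Nu; apply/slabP; exists (h - g).
  have -> : h - g + u = h + z + (w, 0) by rewrite ue; zmod.
  split; first exact: latticeB.
    have -> : (h + z + (w, 0)).1 = a by rewrite -ba -hb.
    exact: ltW.
  by rewrite /= addr0; exact: bdryP.
by split; exact: incl.
Qed.

(** The points [z + (v, 0)], for translations [v] realizing closeness, are reduced modulo [Gam] into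
    a compact set; [w] is a cluster point as the precision tends to 0. *)
Lemma proximal_cluster L L' z : proximal L L' -> exists w : E,
  forall (N : set E) (e : R), nbhs w N -> 0 < e -> exists (e' : R) (v : V) (x : E),
    [/\ 0 < e', e' <= e, N x, Gam (x - (z + (v, 0))) &
        Defs.close e' (translate L v) (translate L' v)].
Proof.
move=> pLL'; have [_ _ _ [C [cC EC]]] := lat.
pose B (e : R) : set E := [set x | C x /\ exists (e' : R) (v : V),
  [/\ 0 < e', e' <= e, Gam (x - (z + (v, 0))) &
      Defs.close e' (translate L v) (translate L' v)]].
pose F := filter_from [set e : R | 0 < e] B.
have FF : ProperFilter F.
  apply: filter_from_proper.
    apply: filter_from_filter; first by exists 1 => /=; exact: ltr01.
    move=> e1 e2 /= e10 e20; exists (Num.min e1 e2); first by rewrite /= lt_min e10.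
    move=> x [Cx [e' [v [e'0]]]]; rewrite le_min => /andP[le1 le2] gx cl.
    by split; split => //; exists e', v; split.
  move=> e /= e0; have [v cl] := pLL' e e0.
  have [c [g [Cc gg zc]]] := EC (z + (v, 0)).
  exists c; split => //; exists e, v; split => //.
  rewrite zc; have -> : c - (c + g) = - g by zmod.
  exact: latticeN.
have FC : F C by exists 1; [exact: ltr01|move=> x []].
have [w [_ Fw]] := cC F FF FC.
exists w => N e nN e0; have Fe : F (B e) by exists e.
have [x [[Cx [e' [v [e'0 e'e gx cl]]]] Nx]] := Fw _ _ Fe nN.
by exists e', v, x.
Qed.

(** Points of the interior-window model set of [w] are nearly seen in translates of [L], hence in
    those of [L'], whose upper bound passes to the limit [w + (z' - z)]. One-sided closeness lets
    the roles of [L] and [L'] be exchanged. *)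
Lemma close1_limit_slab L L' z z' (w : E) :
  (forall (N : set E) (e : R), nbhs w N -> 0 < e -> exists (e' : R) (v : V) (x : E),
    [/\ 0 < e', e' <= e, N x, Gam (x - (z + (v, 0))) &
        close1 e' (translate L v) (translate L' v)]) ->
  modelset Gam (interior K) z `<=` L -> L' `<=` modelset Gam K z' ->
  forall g, Gam g -> interior K (g + w).2 -> slab [set (g + w).1] K (w + (z' - z)).
Proof.
move=> hlim zL L'z' g gg ig; apply: slab_limit => //; first exact: compact_set1.
move=> N /nbhs0_box[r r0 [N2 n2 rN]].
have r2 : 0 < r / 2 by lra.
have [e e0 [er ae]] := exists_eps (`|(g + w).1| + r) r2.
have nP : nbhs (0 : E) ([set u : E | `|u.1| < r / 2] `&`
    [set u : E | N2 u.2 /\ interior K ((g + w).2 + u.2)]).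
  apply: filterI; first exact: near0_fst.
  exact: near0_snd (filterI n2 (near_add0 (nbhs_interior ig))).
have [e' [v [x [e'0 e'e [/= xr [xN2 xK]] gx cl]]]] := hlim _ e (@nbhs_subr G w _ nP) e0.
have gxE : g + x = g + w + (x - w) by zmod.
have xM : modelset Gam (interior K) (z + (v, 0)) (g + x).1.
  rewrite (@modelset_shift _ (z + (v, 0)) x); last exact: latticeBC.
  by exists g => //; split => //; rewrite gxE.
have [b [[b0 L'b0 b0b] xb]] : exists b, translate L' v b /\ `|(g + x).1 - b| < e'.
  apply: cl; first by move: xM; rewrite -translate_modelset => -[a /zL La <-]; exists a.
  have ie : e^-1 <= e'^-1 by rewrite lef_pV2.
  have := ler_normD (g + w).1 (x - w).1; have -> : (g + w).1 + (x - w).1 = (g + x).1.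
    by rewrite gxE.
  by move: xr; rewrite /=; lra.
have [h [gh Kh] hb] : modelset Gam K (x + (z' - z)) b.
  rewrite (@modelset_shift _ (x + (z' - z)) (z' + (v, 0))); last first.
    by have -> : x + (z' - z) - (z' + (v, 0)) = x - (z + (v, 0)) by zmod.
  by rewrite -translate_modelset; exists b0 => //; exact: L'z'.
have e1 : x.1 - w.1 + ((g + w).1 - b) = (g + x).1 - b by rewrite /=; zmod.
exists (x - w + ((g + w).1 - b, 0)).
  apply: rN; last by move: xN2; rewrite /= addr0.
  by change (`|x.1 - w.1 + ((g + w).1 - b)| < r); rewrite e1; lra.
apply/slabP; exists h.
have -> : h + (w + (z' - z) + (x - w + ((g + w).1 - b, 0))) =
   h + (x + (z' - z)) + ((g + w).1 - b, 0) by zmod.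
split => //; last by move: Kh; rewrite /= addr0.
change ((h + (x + (z' - z))).1 + ((g + w).1 - b) = (g + w).1).
by rewrite hb; zmod.
Qed.

Lemma lattice_snd_dense (w : E) (A : set H) : open A -> A !=set0 ->
  exists2 g, Gam g & A (g + w).2.
Proof.
move=> oA [h Ah]; have [_ _ _ dG2] := prj.
have [||h' [/= Ah' [g gg gh]]] := dG2 [set h | A (h + w.2)].
- by exists (h - w.2) => /=; rewrite subrK.
- exact: open_shift.
by exists g => //=; rewrite gh.
Qed.

(** Each visible [g] is matched with some [h] in [Gam] such that [(g - h).1 = d.1]; injectivity of
    the first projection makes [g - h] a constant [g0]. Density of the coordinates [(g + w).2] and
    closedness of [K] extend the inclusion to all of [K]. *)
Lemma slab_translation (w d : E) : K !=set0 ->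
  (forall g, Gam g -> interior K (g + w).2 -> slab [set (g + w).1] K (w + d)) ->
  exists2 g0, Gam g0 & g0.1 = d.1 /\ forall k, K k -> K (k + (d - g0).2).
Proof.
move=> [k0 Kk0] sl; have [inj1 _ _ _] := prj; have [_ KE _] := win.
have : closure (interior K) k0 by rewrite -KE.
move=> /(_ setT filterT)[k1 [ik1 _]].
have step g : Gam g -> interior K (g + w).2 ->
    exists h, [/\ Gam h, (g - h).1 = d.1 & K (h + (w + d)).2].
  move=> gg /(sl _ gg)/slabP[h [gh e1 Kh]]; exists h; split => //.
  have : (h + (w + d)).1 = (g + w).1 by [].
  rewrite /= => e1'.
  have -> : d.1 = h.1 + (w.1 + d.1) - h.1 - w.1 by zmod.
  by rewrite e1'; zmod.
have [g1 gg1 ig1] := lattice_snd_dense w (@open_interior _ K) (ex_intro _ _ ik1).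
have [h1 [gh1 d1 _]] := step _ gg1 ig1.
exists (g1 - h1); [exact: latticeB|split => //] => k Kk.
apply: clK => N nN.
have nN' : nbhs k [set h | N (h + (d - (g1 - h1)).2)] by exact: cvg_addr nN.
have : closure (interior K) k by rewrite -KE.
move=> /(_ _ (nbhs_interior nN'))[k2 [ik2 Nk2]].
have [g gg [igw Ngw]] := lattice_snd_dense w
   (openI (@open_interior _ K) (@open_interior _ [set h | N (h + (d - (g1 - h1)).2)]))
   (ex_intro _ _ (conj ik2 Nk2)).
have [h [gh dh Kh]] := step _ gg igw.
have e : g - h = g1 - h1.
  by apply: inj1; [exact: latticeB|exact: latticeB|rewrite dh].
exists ((g + w).2 + (d - (g1 - h1)).2); split; last exact: nbhs_singleton Ngw.
have -> : (g + w).2 + (d - (g1 - h1)).2 = (h + (w + d)).2; last by [].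
by rewrite -e /=; zmod.
Qed.

(** Comparing windows in both directions shows that [K] is mapped into itself by the shifts [t] and
    [- t]. So [t] stabilizes [K] and vanishes, and [z' - z] is the lattice point [g0]. *)
Lemma proximal_same_fiber L L' : K !=set0 -> Om L -> Om L' -> proximal L L' ->
  Gam (mu L' - mu L).
Proof.
move=> K0 OmL OmL' pLL'; have [inj1 _ _ _] := prj; have [_ _ stab] := win.
have gz z : Gam (z - z) by rewrite subrr; exact: lattice0.
set z := mu L; set z' := mu L'.
have [w hw] := proximal_cluster z pLL'.
have [g0 gg0 [g01 Kg0]] : exists2 g0, Gam g0 &
    g0.1 = (z' - z).1 /\ forall k, K k -> K (k + ((z' - z) - g0).2).
  apply: (@slab_translation w) => //.
  apply: (@close1_limit_slab L L'); [|exact: fiber_sup|exact: fiber_sub].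
  move=> N e nN e0; have [e' [v [x [? ? ? ? []]]]] := hw N e nN e0.
  by exists e', v, x.
have [g1 gg1 [g11 Kg1]] : exists2 g1, Gam g1 &
    g1.1 = (z - z').1 /\ forall k, K k -> K (k + ((z - z') - g1).2).
  apply: (@slab_translation (w + (z' - z))) => //.
  apply: (@close1_limit_slab L' L); [|exact: fiber_sup|exact: fiber_sub].
  move=> N e nN e0; have nN' := @cvg_addr G (z' - z) w N nN.
  have [e' [v [x [e'0 e'e Nx gx [_ cl]]]]] := hw _ e nN' e0.
  exists e', v, (x + (z' - z)); split => //.
  by have -> : x + (z' - z) - (z' + (v, 0)) = x - (z + (v, 0)) by zmod.
have e01 : g1 = - g0.
  apply: inj1 => //; first exact: latticeN.
  by rewrite g11 /= g01 /=; zmod.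
set t := (z' - z - g0).2 in Kg0.
have t0 : t = 0.
  apply: stab; apply/seteqP; split => [_ [k Kk <-]|k Kk]; first exact: Kg0.
  exists (k - t); last by rewrite subrK.
  have -> : k - t = k + ((z - z') - g1).2; last exact: Kg1.
  by rewrite e01 /t /=; zmod.
have -> : z' - z = g0; last by [].
have e2 : (z' - z).2 = g0.2 by apply/eqP; rewrite -subr_eq0; apply/eqP; exact: t0.
by rewrite [LHS]surjective_pairing -g01 e2 -surjective_pairing.
Qed.

Lemma modelset_eq_hull z v g : Gam g -> z = (v, 0) + g -> Om (modelset Gam K z).
Proof. by move=> gg ->; exact: hull_modelset. Qed.

(** * Elements of a fibre as limits of model sets along ultrafilters *)

Section UltraLimit.
Variables (F : set_system E) (z : E).
Hypotheses (uF : UltraFilter F) (F0 : nbhs (0 : E) `<=` F)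
  (FZ : F [set u : E | exists v g, Gam g /\ z + u = (v, 0) + g]).

(** The limit along [F] of the model sets of [z + u]: a lattice point is kept when its window
    condition holds for [F]-many [u], and is placed at its limiting position. By [FZ] these model
    sets are translates of the one at 0. *)
Definition ultra_limit : set V :=
  [set a | exists g, [/\ Gam g, F [set u : E | K (g + z + u).2] & a = (g + z).1]].

Let FF : ProperFilter F. Proof. exact: ultra_proper. Qed.

Let isolated (c : E) : \forall y \near c, Gam (y - z) -> y = c.
Proof.
have di := @discrete_isolated G Gam hausdorff_space_VH latticeB lattice_discrete (c - z).
have ic : nbhs c [set y : E | Gam (y - z) -> y - z = c - z] := @cvg_addr G (- z) c _ di.
by apply: filterS ic => y h gy; exact: addIr (h gy).
Qed.

(** Here [c] stands for a point [g + z + u] accepted by the window. Near a fixed [c], isolation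
    forces [c' - u = c]; either [F]-many [u] accept [c + u], or [u] is restricted to those rejecting
    it. Compactness makes this uniform. *)
Lemma ultra_limit_upper (C : set E) : compact C -> (forall c, C c -> K c.2) ->
  F [set u | forall c, C c -> Gam (c - u - z) -> F [set u' : E | K (c - u + u').2]].
Proof.
move=> cC CK; have [+ _] := compact_near_coveringP C.
move=> /(_ cC E F (fun u c => K c.2 -> Gam (c - u - z) ->
  F [set u' : E | K (c - u + u').2])) h.
suff hC : \forall u \near F, C `<=` (fun c => K c.2 -> Gam (c - u - z) ->
    F [set u' : E | K (c - u + u').2]).
  by apply: filterS hC => u hu c Cc; apply: hu => //; exact: CK.
apply: h => c Cc.
have ic : nbhs (c - 0 : E) [set y | Gam (y - z) -> y = c] by rewrite subr0; exact: isolated.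
have [[N1 N2] /= [n1 n2] N12] := @near_sub G c 0 _ ic.
have [Jc|nJc] := in_ultra_setVsetC [set u : E | K (c + u).2] uF.
  exists (N1, N2); first by split => //; exact: F0.
  move=> [c' u] Ncu.
  change (K c'.2 -> Gam (c' - u - z) -> F [set u' : E | K (c' - u + u').2]) => _ gc.
  by have -> : c' - u = c := N12 (c', u) Ncu gc.
exists (N1, N2 `&` ~` [set u : E | K (c + u).2]).
  by split => //; apply: filterI nJc; exact: F0.
move=> [c' u] [/= N1c [N2u nK]].
change (K c'.2 -> Gam (c' - u - z) -> F [set u' : E | K (c' - u + u').2]) => Kc' gc.
case: nK; have <- : c' - u = c := N12 (c', u) (conj N1c N2u) gc.
by change (K (c' - u + u).2); have -> : c' - u + u = c' by zmod.
Qed.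

(** The same dichotomy at limiting points [c = g + z]: if [F]-many [u] accept [c + u], restrict to
    them; otherwise the premise fails. *)
Lemma ultra_limit_lower (C : set E) : compact C ->
  F [set u | forall c, C c -> Gam (c - z) -> F [set u' : E | K (c + u').2] ->
    K (c + u).2].
Proof.
move=> cC; have [+ _] := compact_near_coveringP C.
move=> /(_ cC E F (fun u c => Gam (c - z) -> F [set u' : E | K (c + u').2] ->
  K (c + u).2)); apply => c Cc.
have [Jc|nJc] := in_ultra_setVsetC [set u : E | K (c + u).2] uF.
  exists ([set y | Gam (y - z) -> y = c], [set u : E | K (c + u).2]).
    by split => //; exact: isolated.
  move=> [c' u] [/= c'c Kcu].
  change (Gam (c' - z) -> F [set u' : E | K (c' + u').2] -> K (c' + u).2).
  by move=> /c'c ->.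
exists ([set y | Gam (y - z) -> y = c], setT).
  by split; [exact: isolated|exact: filterT].
move=> [c' u] [/= c'c _].
change (Gam (c' - z) -> F [set u' : E | K (c' + u').2] -> K (c' + u).2).
move=> /c'c -> Jc.
by have [x [/= + Kx]] := filter_ex (filterI nJc Jc); case.
Qed.

Lemma ultra_limit_close (e : R) : 0 < e ->
  F [set u | Defs.close e ultra_limit (modelset Gam K (z + u))].
Proof.
move=> e0; pose C : set E := [set v | `|v| <= e^-1] `*` K.
have cC : compact C by apply: compact_setX cK; exact: compact_norm_le.
have CK c : C c -> K c.2 by case.
have Fe : F [set u : E | `|u.1| < e] by apply: F0; exact: near0_fst.
apply: filterS (filterI Fe (filterI (ultra_limit_upper cC CK) (ultra_limit_lower cC))).
move=> u [/= ue [up low]]; split=> a.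
  move=> [g [gg Fg ag]] ae; exists (g + (z + u)).1.
  have -> : (g + (z + u)).1 = a + u.1 by rewrite ag /= addrA.
  have uE : a - (a + u.1) = - u.1 by zmod.
  split; last by rewrite uE normrN.
  rewrite -[a + u.1]/((a, 0) + u : E).1.
  exists g; last by rewrite ag /= addrA.
  split => //; have -> : g + (z + u) = g + z + u by zmod.
  apply: low => //; last by have -> : g + z - z = g by zmod.
  split; first by rewrite /= -[g.1 + z.1]/(g + z).1 -ag ltW.
  (* [low] speaks only of points of [C]. The limiting window coordinate lies in the closed set [K]
     because [F] refines the neighbourhoods of 0. *)
  apply: clK => N nN.
  have FN : F [set u : E | N ((g + z).2 + u.2)].
    by apply: F0; exact: near0_snd (near_add0 nN).
  have [x [/= Nx Kx]] := filter_ex (filterI FN Fg).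
  by exists ((g + z).2 + x.2).
move=> [g [gg Kg] ga] ae; exists (g + z).1; split.
  exists g; split => //.
  have e1 : g + (z + u) - u = g + z by zmod.
  rewrite -e1; apply: up; first by split => //=; rewrite -[X in `|X|]/(g + (z + u)).1 ga ltW.
  by rewrite e1; have -> : g + z - z = g by zmod.
by rewrite -ga; have -> : (g + (z + u)).1 - (g + z).1 = u.1 by rewrite /=; zmod.
Qed.

Lemma ultra_limit_hull : Om ultra_limit.
Proof.
move=> e e0; have [u [cl [v [g [gg zu]]]]] := filter_ex (filterI (ultra_limit_close e0) FZ).
exists v; rewrite translate_modelset add0r.
rewrite (@modelset_shift K (v, 0) (z + u)) //.
rewrite zu; have -> : (v, 0) - ((v, 0) + g) = - g by zmod.
exact: latticeN.
Qed.

(** The model sets of nonsingular points [z + u] have image [z + u] and approach the limit, so by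
    continuity [p] is arbitrarily close to lattice points; isolation then puts [p] in [Gam]. *)
Lemma ultra_limit_fiber : Gam (mu ultra_limit - z).
Proof.
set p := mu ultra_limit - z; have [fac1 _ _ _] := fac.
have di := @discrete_isolated G Gam hausdorff_space_VH latticeB lattice_discrete p.
have d0 := @near_add0 G p _ di.
have d00 : nbhs (0 - 0 : E) [set w | Gam (p + w) -> p + w = p] by rewrite subr0.
have [[N1 N2] /= [n1 n2] N12] := @near_sub G 0 0 _ d00.
have [e e0 h] := fiber_cont ultra_limit_hull n1.
have [u [N2u [cl [v [g [gg zu]]]]]] :=
  filter_ex (filterI (F0 n2) (filterI (ultra_limit_close e0) FZ)).
have [m N1m gm] := h _ (modelset_eq_hull gg zu) cl.
have g1 : Gam (mu (modelset Gam K (z + u)) - (z + u)).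
  by apply: fac1; rewrite zu; exact: NS_shift.
have gp : Gam (p + (m - u)).
  have -> : p + (m - u) = mu (modelset Gam K (z + u)) - (z + u)
     - (mu (modelset Gam K (z + u)) - (mu ultra_limit + m)) by rewrite /p; zmod.
  exact: latticeB.
by rewrite -(N12 (m, u) (conj N1m N2u) gp).
Qed.

End UltraLimit.

(** A small [(0, h)] moves [k] into the open set [A], and density then reaches the orbit of 0
    without leaving [A]. Hence the admissible [u] accumulate at 0 and carry an ultrafilter. *)
Lemma ultrafilter_side z (k : H) (A : set H) : open A -> closure A k ->
  exists F : set_system E, [/\ UltraFilter F, nbhs (0 : E) `<=` F,
    F [set u : E | exists v g, Gam g /\ z + u = (v, 0) + g] &
    F [set u : E | A (k + u.2)]].
Proof.
move=> oA clA.
pose Z := [set u : E | exists v g, Gam g /\ z + u = (v, 0) + g].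
pose D := Z `&` [set u : E | A (k + u.2)].
have clD : closure D (0 : E).
  move=> N nN; have [r r0 [N2 n2 rN]] := nbhs0_box (nbhs_interior nN).
  have [h N2h Akh] := mem_closure_approx clA n2.
  have nP : nbhs (0 : E) ([set w : E | N ((0, h) + w)] `&` [set w : E | A (k + h + w.2)]).
    apply: filterI.
      by apply: (@near_add0 G (0, h) N); apply: rN => //=; rewrite normr0.
    exact: near0_snd (near_add0 (open_nbhs_nbhs (conj oA Akh))).
  have [v [g [u [gg [/= Nu Au] zu]]]] := dense_approx (z + (0, h)) nP.
  exists ((0, h) + u); split => //; split.
    by exists v, g; split => //; rewrite -zu; zmod.
  by rewrite /= addrA.
have FD := within_nbhs_proper clD.
have [F [uF sF]] := ultraFilterLemma FD.
have FF : ProperFilter F by exact: ultra_proper.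
have FD' : F D by apply: sF; exact: withinT.
exists F; split => //.
- by move=> N nN; apply: sF; apply: filterS nN => x Nx _.
- by apply: filterS FD' => x [].
- by apply: filterS FD' => x [].
Qed.

(** The lattice point [- g] has window coordinate [k] on the boundary; it is kept along [F1], from
    inside [K], and dropped along [F2], from outside. Injectivity of the first projection excludes
    another lattice point at the same position. *)
Lemma fiber_two z : Ssing Gam K z ->
  exists L1 L2, [/\ Om L1 /\ Gam (mu L1 - z), Om L2 /\ Gam (mu L2 - z) & L1 <> L2].
Proof.
move=> [k [g [[clk nik] gg zk]]]; have [inj1 _ _ _] := prj; have [_ KE _] := win.
have Kk : K k by exact: clK.
have cl1 : closure (interior K) k by rewrite -KE.
have cl2 : closure (~` K) k.
  move=> N nN; apply: contrapT => h; apply: nik.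
  apply: filterS nN => x Nx; apply: contrapT => nKx; apply: h; by exists x.
have [F1 [u1 F10 F1Z F1K]] := ultrafilter_side z (@open_interior _ K) cl1.
have [F2 [u2 F20 F2Z F2K]] := ultrafilter_side z (closed_openC clK) cl2.
have gz u : (- g + z + u).2 = k + u.2 by rewrite /= zk; zmod.
exists (ultra_limit F1 z), (ultra_limit F2 z); split.
- by split; [exact: ultra_limit_hull|exact: ultra_limit_fiber].
- by split; [exact: ultra_limit_hull|exact: ultra_limit_fiber].
move=> E12; have : ultra_limit F1 z (- g + z).1.
  exists (- g); split => //; first exact: latticeN.
  have FF1 : ProperFilter F1 by exact: ultra_proper.
  by apply: filterS F1K => u iu; rewrite /= -[X in K X]/(- g + z + u).2 gz; exact: interior_subset.
rewrite E12 => -[g' [gg' F2g /=]] /addIr e1.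
have gE : - g = g' by apply: inj1 => //; exact: latticeN.
have FF2 : ProperFilter F2 by exact: ultra_proper.
have [u [/= nK]] := filter_ex (filterI F2K F2g).
by rewrite -gE -[X in K X]/(- g + z + u).2 gz.
Qed.

Lemma fiber_distal_NS z : ~ Ssing Gam K z -> fiber_distal Gam K mu z.
Proof.
move=> nsz hullM L OmL gL L' OmL' pLL'.
have [K0|K0] := pselect (K !=set0).
  rewrite (fiber_NS nsz OmL gL); apply: fiber_NS => //.
  have -> : mu L' - z = (mu L' - mu L) + (mu L - z) by zmod.
  by apply: latticeD => //; exact: proximal_same_fiber.
(* With an empty window every hull element is empty. *)
have hull0 M : Om M -> M = set0.
  move=> OmM; apply/seteqP; split => // a Ma.
  have gM : Gam (mu M - mu M) by rewrite subrr; exact: lattice0.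
  by have [g [_ Kg] _] := fiber_sub OmM gM Ma; case: K0; exists (g + mu M).2.
by rewrite (hull0 L' OmL') (hull0 L OmL).
Qed.

Lemma fiber_distal_Ssing z : Ssing Gam K z -> ~ fiber_distal Gam K mu z.
Proof.
move=> /fiber_two[L1 [L2 [[OmL1 g1] [OmL2 g2] L12]]] fd; apply: L12; apply: esym.
by apply: (fd L1 OmL1 g1 L2 OmL2); exact: (fiber_proximal OmL1 OmL2 g1 g2).
Qed.

End ModelSetHull.

(** * Haar measures *)

(** Integration of a pointwise inequality between simple functions; it reduces the averaging
    arguments to finite sums. A side with one term is written as a sum over [[:: tt]]. *)
Lemma le_measure_wsum d (T : measurableType d) (R : realType)
    (m : {measure set T -> \bar R}) (I J : Type) (s : seq I) (t : seq J)
    (a : I -> R) (A : I -> set T) (b : J -> R) (B : J -> set T) :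
  (forall i, 0 <= a i) -> (forall j, 0 <= b j) ->
  (forall i, measurable (A i)) -> (forall j, measurable (B j)) ->
  (forall x, \sum_(i <- s) a i * \1_(A i) x <= \sum_(j <- t) b j * \1_(B j) x) ->
  (\sum_(i <- s) (a i)%:E * m (A i) <= \sum_(j <- t) (b j)%:E * m (B j))%E.
Proof.
move=> a0 b0 mA mB le_ab.
have mf (c : R) (C : set T) : measurable C ->
    measurable_fun setT ((fun x => c%:E * (\1_C x)%:E)%E : T -> \bar R).
  move=> mC; under eq_fun do rewrite -EFinM.
  apply/measurable_EFinP; apply: measurable_funM; first exact: measurable_cst.
  exact: measurable_indic.
have int (c : R) (C : set T) : 0 <= c -> measurable C ->
    (c%:E * m C)%E = (\int[m]_(x in setT) (c%:E * (\1_C x)%:E))%E.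
  move=> c0 mC; rewrite ge0_integralZl_EFin //; first by rewrite integral_indic// setIT.
  - by apply/measurable_EFinP; exact: measurable_indic.
under eq_bigr do rewrite (int _ _ (a0 _) (mA _)).
under [leRHS]eq_bigr do rewrite (int _ _ (b0 _) (mB _)).
have ge0 (c : R) (C : set T) x : 0 <= c -> (0 <= c%:E * (\1_C x)%:E)%E.
  by move=> c0; rewrite -EFinM lee_fin mulr_ge0.
rewrite -!ge0_integral_sum //; try by [move=> i; exact: mf | move=> i x _; exact: ge0].
apply: ge0_le_integral => //.
- by move=> x _; apply: sume_ge0 => i _; exact: ge0.
- by apply: emeasurable_sum => i; exact: mf.
- by apply: emeasurable_sum => i; exact: mf.
- move=> x _; under eq_bigr do rewrite -EFinM; under [leRHS]eq_bigr do rewrite -EFinM.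
  by rewrite !sumEFin lee_fin.
Qed.

Lemma open_measurable_Hm (H : topologicalZmodType) (U : set H) :
  open U -> measurable (U : set (Hm H)).
Proof. by move=> oU; exact: sub_sigma_algebra. Qed.

Lemma closed_measurable_Hm (H : topologicalZmodType) (C : set H) :
  closed C -> measurable (C : set (Hm H)).
Proof.
move=> cC; rewrite -[C]setCK; apply: measurableC; apply: open_measurable_Hm.
exact: closed_openC.
Qed.

(** * Finite partitions of compact sets into small measurable pieces *)

Section SmallPartition.
Variables (R : realType) (H : topologicalZmodType).
Implicit Types (Q W : set H).

(** Disjointification along the list: the head takes the part of [Q] in its translate of [W], and
    the induction splits the rest. The sum of indicators states disjointness and covering at
    once. *)
Lemma small_partition Q W (l : seq H) : open W -> measurable (Q : set (Hm H)) ->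
  (forall x, Q x -> exists2 y, y \in l & W (x - y)) ->
  exists P : nat -> set H, [/\ forall i, measurable (P i : set (Hm H)),
    forall i x, P i x -> W (x - nth 0 l i) &
    forall x, \sum_(i < size l) \1_(P i) x = \1_Q x :> R].
Proof.
move=> oW; elim: l Q => [|y l IH] Q mQ cov.
  exists (fun=> set0); split => // x; rewrite big_ord0 indicE memNset// => /cov[] //.
pose Wy := [set x | W (x - y)].
have mWy : measurable (Wy : set (Hm H)).
  by apply: open_measurable_Hm; exact: open_shift.
have [||P [mP PW PQ]] := IH (Q `\` Wy).
- exact: measurableD.
- move=> x [Qx nW]; have [z] := cov x Qx; rewrite inE => /orP[/eqP -> //|zl Wz].
  by exists z.
exists (fun i => if i is j.+1 then P j else Q `&` Wy); split.
- by case => //; exact: measurableI.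
- by case => [x []|].
move=> x; rewrite big_ord_recl (eq_bigr (fun i : 'I_(size l) => \1_(P i) x))//.
rewrite PQ !indicE [in LHS]/=.
have [Qx|Qx] := pselect (Q x); last first.
  by rewrite (memNset Qx) !memNset ?addr0// => -[].
rewrite (mem_set Qx); have [Wx|Wx] := pselect (Wy x).
  by rewrite (mem_set (conj Qx Wx : (Q `&` Wy) x)) memNset ?addr0// => -[].
by rewrite (mem_set (conj Qx Wx : (Q `\` Wy) x)) memNset ?add0r// => -[].
Qed.

Lemma mass_partition (m : {measure set (Hm H) -> \bar R}) Q W (Y : set H) :
  hausdorff_space H -> is_haar m -> compact Q -> open W ->
  (forall x, Q x -> exists2 y, Y y & W (x - y)) ->
  exists (N : nat) (y : nat -> H) (P : nat -> set H) (c : nat -> R),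
  [/\ forall i : 'I_N, Y (y i),
      forall i, [/\ measurable (P i : set (Hm H)), 0 <= c i & m (P i) = (c i)%:E],
      forall (i : 'I_N) x, P i x -> W (x - y i),
      forall x, \sum_(i < N) \1_(P i) x = \1_Q x :> R &
      m Q = (\sum_(i < N) c i)%:E].
Proof.
move=> hH [_ mfin _ _ _] cQ oW covY.
have mQ : measurable (Q : set (Hm H)).
  by apply: closed_measurable_Hm; exact: compact_closed.
have [l [lY lcov]] := compact_cover_shifts cQ oW covY.
have [P [mP PW PQ]] := small_partition oW mQ lcov.
(* Pieces beyond the list are emptied, so that every [P' i] lies in [Q] and has finite mass. *)
pose P' i := if (i < size l)%N then P i else set0.
have P'E (i : 'I_(size l)) : P' i = P i by rewrite /P' ltn_ord.
have mP' i : measurable (P' i : set (Hm H)) by rewrite /P'; case: ifP.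
have PQ' x : \sum_(i < size l) \1_(P' i) x = \1_Q x :> R.
  by rewrite -PQ; apply: eq_bigr => i _; rewrite P'E.
have P'Q i : P' i `<=` Q.
  rewrite /P'; case: ifP => [il x Pix|_ x []]; apply: contrapT => nQ.
  have := PQ x; rewrite [RHS]indicE memNset// (bigD1 (Ordinal il))//= indicE mem_set// => h.
  have : 0 <= \sum_(j < size l | j != Ordinal il) \1_(P j) x :> R.
    by apply: sumr_ge0.
  by move: h => /=; lra.
have Pfin i : m (P' i) \is a fin_num.
  rewrite ge0_fin_numE ?measure_ge0//; apply: le_lt_trans (mfin Q cQ).
  by apply: le_measure; rewrite ?inE//; exact: P'Q.
exists (size l), (nth 0 l), P', (fun i => fine (m (P' i))); split => //.
- by move=> i; apply: lY; exact: mem_nth.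
- by move=> i; rewrite fine_ge0// fineK.
- by move=> i x; rewrite P'E; exact: PW.
rewrite -sumEFin; under [RHS]eq_bigr do rewrite fineK// -[X in m X]/(P' _) -[m _]mul1e.
have mQE : m Q = (\sum_(j <- [:: tt]) 1%:E * m Q)%E by rewrite big_seq1 mul1e.
rewrite [LHS]mQE.
by apply/eqP; rewrite eq_le; apply/andP; split; apply: le_measure_wsum => // x;
  rewrite big_seq1 mul1r; under eq_bigr do rewrite mul1r; rewrite PQ'.
Qed.

End SmallPartition.

(** * Haar measure of saturated boxes in the torus *)

Section HaarMeasures.
Variables (R : realType) (n : nat) (H : topologicalZmodType).
Local Notation V := 'rV[R]_n.
Local Notation E := (V * H)%type.
Local Notation G := (prod_group V H).
Variables (Gam : set E) (mH : {measure set (Hm H) -> \bar R})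
  (mT : {measure set (Tm Gam) -> \bar R}).
Hypotheses (hH : hausdorff_space H) (lat : is_lattice Gam)
  (prj : proj_conditions Gam) (hmH : is_haar mH) (hmT : is_haarT mT).
Implicit Types (B : set V) (D Q : set H) (x y z g : E).

Lemma Topen_measurable (U : set E) : Topen Gam U -> measurable (U : set (Tm Gam)).
Proof. by move=> oU; exact: sub_sigma_algebra. Qed.

Lemma slab_measurable B D : compact B -> compact D ->
  measurable (slab Gam B D : set (Tm Gam)).
Proof.
move=> cB cD; rewrite -[slab _ _ _]setCK; apply: measurableC.
apply: Topen_measurable; split; first exact: closed_openC (slab_closed hH lat cB cD).
move=> x g gg nx sxg; apply: nx; apply: (slab_shift lat) sxg.
by have -> : x + g - x = g by zmod.
Qed.

Lemma slab_setT_bigcup D :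
  slab Gam setT D = \bigcup_k slab Gam [set v : V | `|v| <= k%:R] D.
Proof.
apply/seteqP; split=> z.
  move=> /(slabP lat)[g [gg _ Dg]]; exists (Num.bound `|(g + z).1|) => //.
  by apply/(slabP lat); exists g; split => //=; apply: ltW; exact: archi_boundP.
by move=> [k _ /(slabP lat)[g [gg _ Dg]]]; apply/(slabP lat); exists g.
Qed.

Lemma slab_setT_measurable D : compact D ->
  measurable (slab Gam setT D : set (Tm Gam)).
Proof.
move=> cD; rewrite slab_setT_bigcup; apply: bigcup_measurable => k _.
by apply: slab_measurable => //; exact: compact_norm_le.
Qed.

Lemma translate_slab B D (h : H) :
  translate (slab Gam B D) (0, h) = slab Gam B (translate D h).
Proof.
have e g x : (g + (x - (0, h))).1 = (g + x).1 by rewrite /= subr0.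
have e' g x : (g + (x - (0, h))).2 = (g + x).2 - h by rewrite /= addrA.
rewrite !translateE; apply/seteqP; split => x; have [s1 s2] := slabP lat B D (x - (0, h)).
  move=> sx; have [g [gg]] := s1 sx; rewrite e e' => Bg Dg.
  by apply/(slabP lat); exists g.
by move=> /(slabP lat)[g [gg Bg Dg]]; apply: s2; exists g; rewrite e e'.
Qed.

Lemma compact_translate D (h : H) : compact D -> compact (translate D h).
Proof.
move=> cD; apply: continuous_compact cD.
by apply: continuous_subspaceT => x; exact: cvg_addr.
Qed.

Lemma haar_translate D (h : H) : measurable (D : set (Hm H)) ->
  mH (translate D h) = mH D.
Proof. by case: hmH => + _ _ _ _; apply. Qed.

Lemma translate_measurable_open (U : set H) (h : H) : open U ->
  measurable (translate U h : set (Hm H)).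
Proof. by move=> oU; rewrite translateE; apply: open_measurable_Hm; exact: open_shift. Qed.

Lemma haarT_fin (A : set (Tm Gam)) : measurable A -> mT A \is a fin_num.
Proof.
move=> mA; rewrite ge0_fin_numE ?measure_ge0//.
have [m1 _ _ _] := hmT; apply: (@le_lt_trans _ _ (mT setT)); last by rewrite m1 ltry.
by apply: le_measure; rewrite ?inE.
Qed.

(** The translates of the slab by [(0, - y i)] all have measure [t]. Their sum with weights
    [mH (P i)], of total mass [q], is pointwise at most [size l2] times [e], where [e] bounds the
    mass of an open [U] around [D]. As [l2] does not depend on [e], [t = 0]. *)
Lemma slab_null B D Q : compact B -> compact D -> compact Q ->
  (0 < mH Q)%E -> mH D = 0%E -> mT (slab Gam B D) = 0%E.
Proof.
move=> cB cD cQ Q0 D0; have [_ mHfin _ mHout _] := hmH.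
have mD : measurable (D : set (Hm H)).
  by apply: closed_measurable_Hm; exact: compact_closed.
have mS := slab_measurable cB cD.
have [[N1 N2] /= [n1 n2] N12] := @discrete_near_eq G Gam (lattice_discrete lat) 0.
(* [W2] has at most one point in each coset of [Gam], so a finite cover by its translates bounds the
   number of representatives to be counted. *)
pose W2 : set E := interior ((N1 : set E) `&` N2).
have W2inj x y : W2 x -> W2 y -> Gam (x - y) -> x = y.
  move=> /nbhs_singleton[N1x _] /nbhs_singleton[_ N2y] gxy.
  exact: (N12 (x, y) (conj N1x N2y) gxy).
have cBDQ := compact_setX cB (compact_sub cD cQ).
have W20 : W2 0 by exact: filterI.
have [||l2 [_ l2cov]] := @compact_cover_shifts G _ setT W2 cBDQ.
- exact: open_interior.
- by move=> x _; exists x => //; rewrite subrr.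
have Qfin : mH Q \is a fin_num by rewrite ge0_fin_numE ?measure_ge0//; exact: mHfin.
set q := fine (mH Q); have q0 : 0 < q by apply: fine_gt0; rewrite Q0 mHfin.
set t := fine (mT (slab Gam B D)).
have tE : mT (slab Gam B D) = t%:E by rewrite fineK// haarT_fin.
suff key e : 0 < e -> q * t <= (size l2)%:R * e.
  have t0 : 0 <= t by apply: fine_ge0; exact: measure_ge0.
  rewrite tE; congr EFin; apply/eqP; rewrite eq_le t0 andbT leNgt; apply/negP => tp.
  have s1 : 0 < (size l2)%:R + 1 :> R by rewrite ltr_wpDl.
  have qt := mulr_gt0 q0 tp; have e0 := divr_gt0 qt s1.
  have := key _ e0; have : q * t = ((size l2)%:R + 1) * (q * t / ((size l2)%:R + 1)).
    by rewrite [RHS]mulrC divfK// gt_eqF.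
  by rewrite mulrDl mul1r; lra.
move=> e0; have : (ereal_inf [set mH U | U in [set U : set H | open U /\ D `<=` U]] < e%:E)%E.
  by rewrite -mHout// D0 lte_fin.
move=> /ereal_inf_lt[_ [U [oU DU] <-] Ue].
pose W : set H := interior [set w | forall d, D d -> U (d + w)].
have W0 : W 0 by exact: compact_tube.
have WU w d : W w -> D d -> U (d + w) by move=> /nbhs_singleton; exact.
have [|N [y [P [c [yQ cP PW PQ mQc]]]]] := mass_partition hH hmH cQ (@open_interior _ _ : open W) (Y := Q).
  by move=> x Qx; exists x => //; rewrite subrr.
(* For [x] in [P i] with [h + y i] in [D], the point [x + h] lies in [U]; so the contributing pieces
   fit in a translate of [U], of mass below [e]. *)
have inner (h : H) : \sum_(i < N) c i * \1_D (h + y i) <= e.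
  rewrite -lee_fin -sumEFin; apply: (@le_trans _ _ (mH U)); last exact: ltW.
  rewrite -(haar_translate (- h) (open_measurable_Hm oU)).
  have -> : mH (translate U (- h)) = (\sum_(j <- [:: tt]) 1%:E * mH (translate U (- h)))%E.
    by rewrite big_seq1 mul1e.
  under eq_bigr => i _ do [have [_ _ Pc] := cP i; rewrite mulrC EFinM -Pc].
  apply: le_measure_wsum => //.
  - by move=> i; have [] := cP i.
  - by move=> _; exact: translate_measurable_open.
  move=> x; rewrite big_seq1 mul1r translateE.
  have [Ux|nUx] := pselect (U (x - - h)).
    rewrite [leRHS]indicE mem_set//; apply: (@le_trans _ _ (\sum_(i < N) \1_(P i) x)).
      by apply: ler_sum => i _; rewrite ler_piMl// indicE lern1 leq_b1.
    by rewrite PQ indicE lern1 leq_b1.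
  rewrite big1 // => i _; have [Px|nPx] := pselect (P i x); last first.
    by rewrite [X in _ * X]indicE memNset// mulr0.
  have [Dh|nDh] := pselect (D (h + y i)); last by rewrite indicE memNset// mul0r.
  case: nUx; have -> : x - - h = h + y i + (x - y i) by zmod.
  by apply: WU => //; exact: PW.
pose Di (i : 'I_N) : set (Tm Gam) := slab Gam B (translate D (- y i)).
have mDi i : measurable (Di i) by apply: slab_measurable => //; exact: compact_translate.
have tDi i : mT (Di i) = t%:E.
  have [_ mTtr _ _] := hmT.
  by rewrite -tE -(mTtr _ (0, - y i) mS) translate_slab.
have : (\sum_(i < N) (c i)%:E * mT (Di i) <=
    \sum_(j <- [:: tt]) ((size l2)%:R * e)%:E * mT setT)%E.
  apply: le_measure_wsum => //.
  - by move=> i; have [] := cP i.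
  - by move=> _; rewrite mulr_ge0// ltW.
  move=> z; rewrite big_seq1 indicT mulr1.
  (* [h] is the second coordinate of the only representative of [z] in the [k]-th translate of [W2],
     and 0 if there is none. *)
  have hk (k : nat) : exists h : H, forall g, Gam g -> W2 (g + z - nth 0 l2 k) -> (g + z).2 = h.
    have [[g [gg Wg]]|no] := pselect (exists g, Gam g /\ W2 (g + z - nth 0 l2 k)); last first.
      by exists 0 => g gg Wg; case: no; exists g.
    exists (g + z).2 => g' gg' Wg'; congr snd.
    have : g' + z - nth 0 l2 k = g + z - nth 0 l2 k.
      apply: W2inj => //.
      have -> : g' + z - nth 0 l2 k - (g + z - nth 0 l2 k) = g' - g by zmod.
      exact: (latticeB lat).
    by move/addIr.
  have [h hP] := choice hk.
  apply: (@le_trans _ _ (\sum_(i < N) c i * \sum_(k < size l2) \1_D (h k + y i))).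
    apply: ler_sum => i _; have [_ ci0 _] := cP i; apply: ler_wpM2l => //.
    have [/= |nz] := pselect (Di i z); last first.
      by rewrite indicE memNset//; apply: sumr_ge0.
    move=> /[dup] Dz /(slabP lat)[g [gg Bg]]; rewrite translateE /= opprK => Dg.
    have : (B `*` [set x.1 - x.2 | x in D `*` Q]) (g + z).
      split => //; exists ((g + z).2 + y i, y i) => /=; last by rewrite addrK.
      by split => //; exact: yQ.
    move=> /l2cov[y2 y2l Wy2].
    have kl : (index y2 l2 < size l2)%N by rewrite index_mem.
    rewrite indicE mem_set// (bigD1 (Ordinal kl))//= -(hP (index y2 l2) g gg); last first.
      by rewrite nth_index.
    by rewrite indicE mem_set// lerDl; apply: sumr_ge0.
  under eq_bigr do rewrite mulr_sumr.
  rewrite exchange_big /=; apply: (@le_trans _ _ (\sum_(k < size l2) e)).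
    by apply: ler_sum => k _; exact: inner.
  by rewrite sumr_const card_ord mulr_natl.
have [mT1 _ _ _] := hmT.
rewrite big_seq1 mT1 mule1; under eq_bigr do rewrite tDi.
rewrite -ge0_sume_distrl; last by move=> i _; rewrite lee_fin; have [] := cP i.
by rewrite sumEFin -mQc -(fineK Qfin) -EFinM lee_fin.
Qed.

Lemma Topen_translate (U : set E) (y : E) : Topen Gam U -> Topen Gam (translate U y).
Proof.
rewrite translateE => -[oU Ui]; split; first exact: (@open_shift G U (- y)).
move=> x g gg /= Ux; have -> : x + g - y = x - y + g by zmod.
exact: Ui.
Qed.

(** [A] misses the translates of [slab Gam B D] by [(0, - y i)] with [y i] in the projection of
    [Gam], so it meets those of a tight open [U] in measure at most [e]. With weights [mH (P i)] the
    latter cover every point with total weight at least [p]; hence [p * a <= q * e]. *)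
Lemma slab_setT_conull D : compact D -> (0 < mH D)%E ->
  mT (~` slab Gam setT D) = 0%E.
Proof.
move=> cD D0; have [_ mHfin _ _ _] := hmH; have [_ mTtr mTout _] := hmT.
have mD : measurable (D : set (Hm H)).
  by apply: closed_measurable_Hm; exact: compact_closed.
set A : set (Tm Gam) := ~` slab Gam setT D.
have mA : measurable A by apply: measurableC; exact: slab_setT_measurable.
have [_ _ _ [C [cC EC]]] := lat.
pose B := [set c.1 | c in C]; pose X := [set c.2 | c in C].
have cB : compact B.
  by apply: continuous_compact cC; apply: continuous_subspaceT => x; exact: cvg_fst.
have cX : compact X.
  by apply: continuous_compact cC; apply: continuous_subspaceT => x; exact: cvg_snd.
pose Q := [set x.1 - x.2 | x in D `*` X].
have cQ : compact Q by exact: compact_sub.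
have mS := slab_measurable cB cD.
have Qfin : mH Q \is a fin_num by rewrite ge0_fin_numE ?measure_ge0//; exact: mHfin.
set q := fine (mH Q); have q0 : 0 <= q by apply: fine_ge0; exact: measure_ge0.
have Dfin : mH D \is a fin_num by rewrite ge0_fin_numE ?measure_ge0//; exact: mHfin.
set p := fine (mH D); have p0 : 0 < p by apply: fine_gt0; rewrite D0 mHfin.
set a := fine (mT A); have aE : mT A = a%:E by rewrite fineK// haarT_fin.
suff key e : 0 < e -> p * a <= q * e.
  have a0 : 0 <= a by apply: fine_ge0; exact: measure_ge0.
  rewrite aE; congr EFin; apply/eqP; rewrite eq_le a0 andbT leNgt; apply/negP => ap.
  have s1 : 0 < q + 1 by rewrite ltr_wpDl.
  have pa := mulr_gt0 p0 ap; have e0 := divr_gt0 pa s1.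
  have := key _ e0; have : p * a = (q + 1) * (p * a / (q + 1)).
    by rewrite [RHS]mulrC divfK// gt_eqF.
  by rewrite mulrDl mul1r; lra.
move=> e0.
have Sfin : mT (slab Gam B D) \is a fin_num by exact: haarT_fin.
have : (ereal_inf [set mT U | U in [set U | Topen Gam U /\ slab Gam B D `<=` U]] <
    mT (slab Gam B D) + e%:E)%E.
  by rewrite -mTout// lteDl.
move=> /ereal_inf_lt[_ [U [oU SU] <-] Ue].
have mU := Topen_measurable oU; have [opU Uinv] := oU.
have BDU : B `*` D `<=` U.
  move=> x [Bx Dx]; apply: SU; apply/(slabP lat); exists 0.
  by rewrite add0r; split => //; exact: lattice0.
have [r r0 [N2 n2 rN]] :=
  nbhs0_box (@compact_tube G (B `*` D) U (compact_setX cB cD) opU BDU).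
pose W : set H := interior N2.
have WU (b : V) (d w : H) : B b -> D d -> W w -> U (b, d + w).
  move=> Bb Dd /nbhs_singleton Nw.
  have w0 : `|((0, w) : E).1| < r by rewrite normr0.
  have := rN (0, w) w0 Nw (b, d) (conj Bb Dd).
  by change (U (b + 0, d + w) -> U (b, d + w)); rewrite addr0.
(* Reflected, because [y i - x] will have to lie in [W]. *)
pose W' := [set w | W (- w)].
have oW' : open W' by apply: open_comp (@open_interior _ N2) => w _; exact: opp_continuous.
have [|N [y [P [c [yG cP PW PQ mQc]]]]] :=
    mass_partition (Q := Q) (W := W') (Y := [set g.2 | g in Gam]) hH hmH cQ oW'.
  move=> x _; have oxW : open [set h | W' (x - h)].
    by apply: open_comp oW' => h _; apply: (@continuous_comp _ _ _ -%R (+%R x));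
      [exact: opp_continuous|exact: cvg_addl].
  have [|g gg] := lattice_snd_dense prj (0 : E) oxW.
    by exists x; rewrite /W' /W /= subrr oppr0; exact: n2.
  by rewrite addr0 => Wg; exists g.2 => //; exists g.
(* The [x] with [x + c0.2] in [D] form a set of mass [p] inside [Q]; if such an [x] is in [P i],
   then [y i] is so close to [x] that [z] lies in the translate of [U]. *)
have cover z : p <= \sum_(i < N) c i * \1_(translate U (0, - y i)) z.
  have [c0 [g [Cc0 gg zc]]] := EC z.
  rewrite -lee_fin -sumEFin /p fineK//.
  rewrite -(haar_translate (- c0.2) mD).
  have -> : mH (translate D (- c0.2)) = (\sum_(j <- [:: tt]) 1%:E * mH (translate D (- c0.2)))%E.
    by rewrite big_seq1 mul1e.
  under [leRHS]eq_bigr => i _ do [have [_ _ Pc] := cP i; rewrite mulrC EFinM -Pc].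
  apply: le_measure_wsum => //.
  - by move=> _; apply: closed_measurable_Hm; apply: compact_closed => //; exact: compact_translate.
  - by move=> i; have [] := cP i.
  move=> x; rewrite big_seq1 mul1r translateE.
  have [Dx|nDx] := pselect (D (x - - c0.2)); last first.
    by rewrite [leLHS]indicE memNset//; apply: sumr_ge0 => i _; rewrite mulr_ge0.
  have Qx : Q x.
    exists (x - - c0.2, c0.2) => /=; last by zmod.
    by split => //; exists c0.
  rewrite [leLHS]indicE mem_set//; have := PQ x; rewrite [RHS]indicE mem_set// => <-.
  apply: ler_sum => i _; have [Px|nPx] := pselect (P i x); last first.
    by rewrite [leLHS]indicE memNset// mulr_ge0.
  rewrite [leRHS](_ : _ = \1_(P i) x) // [X in X * _](_ : _ = 1) ?mul1r//.
  rewrite indicE mem_set// translateE /=.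
  have -> : z - (0, - y i) = (c0.1, x - - c0.2 + (y i - x)) + g.
    rewrite zc; case: (c0) => c1 c2 /=; case: (g) => g1 g2; congr pair => /=; zmod.
  apply: Uinv => //; apply: WU => //; first by exists c0.
  by have := PW i x Px; rewrite /W' /= opprB.
pose Si (i : 'I_N) : set (Tm Gam) := slab Gam B (translate D (- y i)).
pose Ui (i : 'I_N) : set (Tm Gam) := translate U (0, - y i).
have mSi i : measurable (Si i) by apply: slab_measurable => //; exact: compact_translate.
have mUi i : measurable (Ui i) by apply: Topen_measurable; exact: Topen_translate.
have SUi i : Si i `<=` Ui i.
  by rewrite /Si -translate_slab /Ui !translateE => x; exact: SU.
(* [A] and [Si i] are disjoint: if [y i = h.2] with [h] in [Gam], adding [h] brings the window
   coordinate back into [D]. *)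
have diff i : (mT (A `&` Ui i) <= e%:E)%E.
  apply: (@le_trans _ _ (mT (Ui i `\` Si i))).
    apply: le_measure; rewrite ?inE; [exact: measurableI|exact: measurableD|].
    move=> z [Az Uz]; split => // /(slabP lat)[g [gg _]]; rewrite translateE /= => Dg.
    have [h gh hy] := yG i; apply: Az; apply/(slabP lat); exists (h + g).
    split => //; first exact: (latticeD lat).
    have -> // : (h + g + z).2 = g.2 + z.2 - - y i by rewrite -hy /=; zmod.
  have Uifin : (mT (Ui i) < +oo)%E by rewrite ltey_eq haarT_fin.
  have tS : mT (Si i) = mT (slab Gam B D) by rewrite /Si -translate_slab; exact: mTtr.
  have tU : mT (Ui i) = mT U by exact: mTtr.
  have le_e : (mT (Ui i) - mT (Si i) <= e%:E)%E.
    by rewrite tS tU leeBlDl//; exact: ltW.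
  by rewrite measureD// setIidr.
have : (\sum_(j <- [:: tt]) p%:E * mT A <= \sum_(i < N) (c i)%:E * mT (A `&` Ui i))%E.
  apply: le_measure_wsum => //.
  - by move=> _; exact: ltW.
  - by move=> i; have [] := cP i.
  - by move=> i; exact: measurableI.
  move=> z; rewrite big_seq1; have [Az|nAz] := pselect (A z); last first.
    rewrite indicE memNset// mulr0; apply: sumr_ge0 => i _.
    by have [_ ci0 _] := cP i; rewrite mulr_ge0.
  rewrite [X in _ * X]indicE mem_set// mulr1; apply: le_trans (cover z) _.
  apply: ler_sum => i _; have [_ ci0 _] := cP i; apply: ler_wpM2l => //.
  have [Uz|nUz] := pselect (Ui i z); last by rewrite indicE memNset.
  by rewrite !indicE !mem_set.
rewrite big_seq1 aE => h.
rewrite -lee_fin EFinM; apply: le_trans h _.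
apply: (@le_trans _ _ (\sum_(i < N) (c i)%:E * e%:E)%E).
  by apply: lee_sum => i _; have [_ ci0 _] := cP i; apply: lee_wpmul2l => //; rewrite lee_fin.
rewrite -ge0_sume_distrl; last by move=> i _; rewrite lee_fin; have [] := cP i.
by rewrite sumEFin -mQc EFinM fineK.
Qed.

End HaarMeasures.

(** * The singular set as a slab, and the two cases of the dichotomy *)

Lemma SsingP (R : realType) (n : nat) (H : topologicalZmodType)
    (Gam : set ('rV[R]_n * H)) (K : set H) (lat : is_lattice Gam) (z : 'rV[R]_n * H) :
  Ssing Gam K z <-> slab Gam setT (bdry K) z.
Proof.
split=> [[k [g [Kk gg zk]]]|/(slabP lat)[g [gg _ Kg]]].
  apply/(slabP lat); exists (- g); split => //; first exact: (latticeN lat).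
  by rewrite /= zk; have -> : - g.2 + (k + g.2) = k by zmod.
exists (g + z).2, (- g); split => //; first exact: (latticeN lat).
by rewrite /=; zmod.
Qed.

Theorem mainTheorem10 (R : realType) (n : nat) (H : topologicalZmodType)
    (Gam : set ('rV[R]_n * H)) (K : set H)
    (mH : {measure set (Hm H) -> \bar R})
    (mT : {measure set (Tm Gam) -> \bar R})
    (mu : set 'rV[R]_n -> 'rV[R]_n * H) :
  hausdorff_space H -> locally_compact [set: H] ->
  is_lattice Gam -> proj_conditions Gam -> is_window K ->
  ~ Ssing Gam K 0 ->
  is_haar mH -> is_haarT mT -> is_factor_map Gam K mu ->
  (mH (bdry K) = 0%E ->
     mT.-negligible (~` [set z | fiber_distal Gam K mu z])) /\
  ((0 < mH (bdry K))%E ->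
     mT.-negligible [set z | fiber_distal Gam K mu z]).
Proof.
move=> hH _ lat prj win NS0 hmH hmT fac.
have [cK KE _] := win; have cD := bdry_compact hH win.
split=> [D0|D0]; last first.
  exists (~` slab Gam setT (bdry K)); split.
  - by apply: measurableC; exact: slab_setT_measurable.
  - exact: (slab_setT_conull hH lat prj hmH hmT cD D0).
  move=> z fdz /(SsingP _ lat) sz.
  exact: (fiber_distal_Ssing hH lat prj win NS0 fac sz fdz).
have fdS : ~` [set z | fiber_distal Gam K mu z] `<=` slab Gam setT (bdry K).
  move=> z nfd; apply/(SsingP _ lat); apply: contrapT => nS; apply: nfd.
  exact: fiber_distal_NS.
suff [A [mA A0 SA]] : mT.-negligible (slab Gam setT (bdry K) : set (Tm Gam)).
  by exists A; split => //; exact: subset_trans fdS SA.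
(* [slab_null] concerns compact [B], so [R^n] is exhausted by countably many balls. *)
rewrite (slab_setT_bigcup lat).
apply: negligible_bigcup => k.
have cB := @compact_norm_le R n k%:R.
exists (slab Gam [set v : 'rV[R]_n | `|v| <= k%:R] (bdry K)); split => //.
  exact: slab_measurable.
(* A nonempty [K] has nonempty interior, so [K] itself serves as the set [Q] of positive measure. *)
have [[k0 Kk0]|K0] := pselect (K !=set0).
  apply: (slab_null hH lat hmH hmT cB cD cK) D0.
  have [_ _ mHpos _ _] := hmH.
  have : closure (interior K) k0 by rewrite -KE.
  move=> /(_ setT filterT)[k1 [ik1 _]].
  apply: (@lt_le_trans _ _ (mH (interior K))).
    by apply: mHpos; [exact: open_interior|exists k1].
  apply: le_measure; rewrite ?inE; last exact: interior_subset.
    by apply: open_measurable_Hm; exact: open_interior.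
  by apply: closed_measurable_Hm; exact: compact_closed.
rewrite (_ : slab _ _ _ = set0) ?measure0//.
apply/seteqP; split => // z /(slabP lat)[g [_ _ [clK _]]].
by case: K0; exists (g + z).2; exact: (compact_closed hH cK).
Qed.
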